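(* Let $G=(V,E)$ be a finite directed acyclic graph and let $V_1,V_2,V_3\subseteq V$ be pairwise disjoint with $V_1,V_2$ non-empty. Then $V_1$ is $p$-separated from $V_2$ given $V_3$ in $G$ if and only if $V_1$ is $d$-separated from $V_2$ given $V_3$ in $G$.
   Context: A directed graph $G=(V,E)$ has finite vertex set $V$ and edges $E\subseteq V\times V$, $(v,w)$ being an edge from $v$ to $w$; $\mathrm{Ch}(v)=\{w:(v,w)\in E\}$, $\mathrm{out}(v)=\{(v,w)\in E\}$. Teleportation graphs. The family $\mathcal G_{\mathrm{tele}}(G)$ consists of all graphs $G_{\mathrm{t}}$ obtained thus: choose $S\subseteq V$ (''split vertices'') such that $(V,E')$ with $E'=E\setminus\bigcup_{v\in S}\mathrm{out}(v)$ is acyclic. The vertices of $G_{\mathrm t}$ are $V\cup\{R_v\}_{v\in S}\cup\{T_v\}_{v\in S}$ with new vertices $R_v$ (pre-selection) and $T_v$ (post-selection). The edges are $E'\cup\{(v,T_v),(R_v,T_v)\}_{v\in S}\cup\{(R_v,w): v\in S,\ w\in\mathrm{Ch}(v)\text{ in }G\}$. Write $T=\{T_v\}_{v\in S}$ for the set of post-selection vertices. $d$-separation. Let $W_1,W_2,W_3$ be disjoint vertex sets of a directed graph, $W_1,W_2$ non-empty. A path is not necessarily directed and involves distinct vertices. A path from $W_1$ to $W_2$ is blocked by $W_3$ if it contains $A\to M\to B$ (in either direction along the path) with $M\in W_3$, or $A\leftarrow M\to B$ with $M\in W_3$, or $A\to M\leftarrow B$ where neither $M$ nor any descendant of $M$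 belongs to $W_3$. $W_1$ and $W_2$ are $d$-separated by (given) $W_3$ if every path from a vertex of $W_1$ to a vertex of $W_2$ is blocked by $W_3$ (in particular if there is none). $p$-separation. $V_1$ is $p$-separated from $V_2$ given $V_3$ in $G$ if there exists $G_{\mathrm t}\in\mathcal G_{\mathrm{tele}}(G)$ such that $V_1$ and $V_2$ are $d$-separated by $V_3\cup T$ in $G_{\mathrm t}$, where $T$ is the set of all post-selection vertices of $G_{\mathrm t}$. *)

(* Defs.v *)
From mathcomp Require Import all_boot.

Set Implicit Arguments.
Unset Strict Implicit.
Unset Printing Implicit Defensive.

(* A finite directed graph is a finite vertex type [U] with an edge relation
   [e : rel U], where [e v w] means that (v, w) is an edge from v to w. *)

(* No directed cycle; [cycle e [:: x]] is [e x x], so loops are excluded too. *)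
Definition acyclic (U : finType) (e : rel U) : Prop :=
  forall c : seq U, cycle e c -> c = [::].

(* A path starting at [x] is a sequence of steps [(d, y)]: the step goes to [y]
   along an edge into [y] if [d = true], and against an edge out of [y] if
   [d = false].  Recording the direction keeps the notion unambiguous in graphs
   that contain both (v, w) and (w, v). *)
Fixpoint traverses (U : finType) (e : rel U) (x : U) (p : seq (bool * U)) :=
  if p is (d, y) :: p' then
    (if d then e x y else e y x) && traverses e y p'
  else true.

Definition is_path (U : finType) (e : rel U) (x : U) (p : seq (bool * U)) :=
  traverses e x p && uniq (x :: map snd p).

Definition path_end (U : finType) (x : U) (p : seq (bool * U)) : U :=
  last x (map snd p).

(* [d1] is the direction of the step entering [m], [d2] that of the step leaving
   it: (true, false) is -> m <-, the other cases are -> m ->, <- m <-, <- m ->.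
   [connect e] is reflexive, so it accounts for [m] and all its descendants. *)
Definition blocks (U : finType) (e : rel U) (W : {set U})
    (d1 : bool) (m : U) (d2 : bool) : bool :=
  match d1, d2 with
  | true, false => [forall w in W, ~~ connect e m w]
  | _, _ => m \in W
  end.

Fixpoint blocked (U : finType) (e : rel U) (W : {set U}) (p : seq (bool * U)) :=
  if p is (d1, m) :: p' then
    (if p' is (d2, _) :: _ then blocks e W d1 m d2 else false) || blocked e W p'
  else false.

(* Meant for pairwise disjoint sets with [W1] and [W2] non-empty. *)
Definition d_separated (U : finType) (e : rel U) (W1 W2 W3 : {set U}) : Prop :=
  forall (x : U) (p : seq (bool * U)),
    x \in W1 -> is_path e x p -> path_end x p \in W2 -> blocked e W3 p.

(* The edge set E' : outgoing edges of the vertices of [S] are removed. *)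
Definition cut_out (V : finType) (e : rel V) (S : {set V}) : rel V :=
  [rel v w | (v \notin S) && e v w].

(* Vertices of the teleportation graph splitting [S]: [inl v] is v itself,
   [inr (inl s)] is R_s and [inr (inr s)] is T_s, for [s] ranging over [S]. *)
Definition tele_vertex (V : finType) (S : {set V}) : finType :=
  (V + ({v : V | v \in S} + {v : V | v \in S}))%type.

Definition orig (V : finType) (S : {set V}) (v : V) : tele_vertex S := inl v.
Definition pre (V : finType) (S : {set V}) (s : {v : V | v \in S}) :
  tele_vertex S := inr (inl s).
Definition post (V : finType) (S : {set V}) (s : {v : V | v \in S}) :
  tele_vertex S := inr (inr s).

Definition tele_edge (V : finType) (e : rel V) (S : {set V}) :
    rel (tele_vertex S) := fun x y =>
  match x, y with
  | inl v, inl w => cut_out e S v w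
  | inl v, inr (inr t) => v == val t
  | inr (inl r), inr (inr t) => r == t
  | inr (inl r), inl w => e (val r) w
  | _, _ => false
  end.

Definition post_set (V : finType) (S : {set V}) : {set tele_vertex S} :=
  [set post s | s : {v : V | v \in S}].

(* The family of teleportation graphs is indexed by the sets [S] for which
   [cut_out e S] is acyclic. *)
Definition p_separated (V : finType) (e : rel V) (V1 V2 V3 : {set V}) : Prop :=
  exists2 S : {set V}, acyclic (cut_out e S) &
    d_separated (tele_edge e (S := S))
      [set orig S v | v in V1] [set orig S v | v in V2]
      ([set orig S v | v in V3] :|: post_set S).

(* Main.v *)
Require Import Defs.
From mathcomp Require Import all_boot.

(** An open path of G lifts to any teleportation graph: each visit of a split
    vertex v is replaced by a visit of v, of R_v, or of v and R_v joined by
    v -> T_v <- R_v, which is open since T_v is conditioned on.  A collider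
    stays open because a directed path from it to V3 either survives or meets
    a first split vertex s, and then T_s is a descendant.  Conversely, splitting
    no vertex gives back G itself. *)

Set Implicit Arguments.
Unset Strict Implicit.
Unset Printing Implicit Defensive.

Lemma traverses_cat (U : finType) (e : rel U) (x : U) (p q : seq (bool * U)) :
  traverses e x (p ++ q) = traverses e x p && traverses e (path_end x p) q.
Proof.
elim: p x => [|[d y] p IHp] x //=.
by rewrite IHp andbA.
Qed.

Lemma path_end_cat (U : finType) (x : U) (p q : seq (bool * U)) :
  path_end x (p ++ q) = path_end (path_end x p) q.
Proof. by rewrite /path_end map_cat last_cat. Qed.

Lemma blocked_cons2 (U : finType) (e : rel U) (W : {set U}) d1 m d2 y p :
  blocked e W ((d1, m) :: (d2, y) :: p) =
    blocks e W d1 m d2 || blocked e W ((d2, y) :: p).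
Proof. by []. Qed.

(** Sends R_v and T_v back to v. This keeps visits of different vertices apart in a lift, and undoes
    [orig] when nothing is split. *)
Definition tele_proj (V : finType) (S : {set V}) (u : tele_vertex S) : V :=
  match u with
  | inl v => v
  | inr (inl r) => val r
  | inr (inr t) => val t
  end.

(** * Lifting paths to a teleportation graph *)

Section Lift.
Variables (V : finType) (e : rel V) (S V3 : {set V}).

Let W := [set orig S v | v in V3] :|: post_set S.

Lemma orig_cond v : (orig S v \in W) = (v \in V3).
Proof.
rewrite inE mem_imset => [|u w [] //].
by rewrite orbC; case: imsetP => // -[].
Qed.

Lemma pre_cond s : (pre s \in W) = false.
Proof. by rewrite inE; apply/negP => /orP[] /imsetP[]. Qed.

Lemma post_cond s : post s \in W.
Proof. by rewrite inE imset_f ?orbT. Qed.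

Lemma tele_descendant v w : connect e v w -> w \in V3 ->
  exists2 t, t \in W & connect (tele_edge e (S := S)) (orig S v) t.
Proof.
case/connectP=> p; elim: p v => [|u p IHp] v /=.
  by move=> _ -> Hw; exists (orig S v); rewrite ?orig_cond.
case/andP=> evu pP lastw w3.
have [vS|vS] := boolP (v \in S).
  exists (post (Sub v vS)); first exact: post_cond.
  by apply: connect1; rewrite /= eqxx.
have [t tW ut] := IHp u pP lastw w3; exists t => //.
by apply: connect_trans ut; apply: connect1; rewrite /= /cut_out /= vS.
Qed.

(* The lift of a path meets a split vertex [x] at R_x along edges out of [x]
   ([b = true]) and at [x] itself along edges into [x] and at the endpoints. *)
Definition port (x : V) (b : bool) : tele_vertex S :=
  if b then (if insub x is Some s then pre s else orig S x) else orig S x.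

(** The detour v -> T_v <- R_v, in either direction. It is empty if the ports agree or if [x] is not
    split, when both ports are [orig S x]. *)
Definition switch_ports (x : V) (b1 b2 : bool) : seq (bool * tele_vertex S) :=
  if b1 == b2 then [::] else
  if insub x is Some s then [:: (true, post s); (false, port x b2)] else [::].

(** [b] is the port of [x] where the lift currently stands. The final switch makes the lift end at
    an original vertex. *)
Fixpoint lift_path (x : V) (b : bool) (p : seq (bool * V)) :=
  if p is (d, y) :: p' then
    switch_ports x b d ++ (d, port y (~~ d)) :: lift_path y (~~ d) p'
  else switch_ports x b false.

Lemma port_edge x y : e x y -> tele_edge e (port x true) (port y false).
Proof.
rewrite /port; case: insubP => [s _ <-//|xS exy].
by rewrite /= /cut_out /= xS.
Qed.

Lemma proj_port x b : tele_proj (port x b) = x.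
Proof. by rewrite /port; case: b => //; case: insubP. Qed.

Lemma traverses_switch x b1 b2 :
  traverses (tele_edge e (S := S)) (port x b1) (switch_ports x b1 b2).
Proof.
rewrite /switch_ports /port; case: eqP => //.
by case: insubP => [s _ sx|] //; case: b1 b2 => [] [] //= _; rewrite sx !eqxx.
Qed.

Lemma path_end_switch x b1 b2 :
  path_end (port x b1) (switch_ports x b1 b2) = port x b2.
Proof.
rewrite /switch_ports /port; case: eqP => [->|] //.
by case: insubP => // _ _; case: b1 b2 => [] [].
Qed.

Lemma traverses_lift x b p : traverses e x p ->
  traverses (tele_edge e (S := S)) (port x b) (lift_path x b p).
Proof.
elim: p x b => [|[d y] p IHp] x b /=; first by rewrite traverses_switch.
case/andP=> exy py; rewrite traverses_cat traverses_switch path_end_switch /=.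
by rewrite IHp // andbT; case: d exy => /port_edge.
Qed.

Lemma path_end_lift x b p :
  path_end (port x b) (lift_path x b p) = orig S (path_end x p).
Proof.
elim: p x b => [|[d y] p IHp] x b /=; first exact: path_end_switch.
by rewrite path_end_cat; apply: IHp.
Qed.

Lemma proj_switch x b1 b2 u : u \in map snd (switch_ports x b1 b2) ->
  tele_proj u = x.
Proof.
rewrite /switch_ports; case: eqP => // _; case: insubP => // s _ sx.
by rewrite !inE => /orP[] /eqP ->; rewrite ?proj_port.
Qed.

Lemma uniq_switch x b1 b2 :
  uniq (port x b1 :: map snd (switch_ports x b1 b2)).
Proof.
rewrite /switch_ports /port; case: eqP => // b12.
by case: insubP => // s _ _; case: b1 b2 b12 => [] [].
Qed.

Lemma proj_lift x b p u : u \in map snd (lift_path x b p) ->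
  tele_proj u \in x :: map snd p.
Proof.
elim: p x b => [|[d y] p IHp] x b /=.
  by move/proj_switch->; rewrite mem_seq1.
rewrite map_cat mem_cat /= in_cons => /or3P[/proj_switch->|/eqP->|/IHp].
- exact: mem_head.
- by rewrite proj_port !inE eqxx orbT.
- by move=> u_p; rewrite in_cons u_p orbT.
Qed.

(** The vertices used while visiting [x] all project to [x], the later ones to later vertices of the
    path, so a repetition could only occur within one visit. *)
Lemma uniq_lift x b p : uniq (x :: map snd p) ->
  uniq (port x b :: map snd (lift_path x b p)).
Proof.
elim: p x b => [|[d y] p IHp] x b; first by move=> _; apply: uniq_switch.
rewrite [map _ _]/= cons_uniq => /andP[xp Up].
rewrite [lift_path _ _ _]/= map_cat -cat_cons cat_uniq uniq_switch.
rewrite [map snd (_ :: _)]/= [X in _ && (_ && X)]IHp // andbT andTb.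
apply/hasPn=> u u_p.
have pu : tele_proj u \in y :: map snd p.
  move: u_p; rewrite in_cons => /predU1P[->|]; last exact: proj_lift.
  by rewrite proj_port mem_head.
apply: contra xp; rewrite inE => /predU1P[uE|/proj_switch <- //].
by move: pu; rewrite uE proj_port.
Qed.

Lemma blocks_post s : blocks (tele_edge e (S := S)) W true (post s) false = false.
Proof.
apply/negbTE/forall_inPn; exists (post s); first exact: post_cond.
by rewrite negbK.
Qed.

(** The excluded directions are those of a collider; R_s has no incoming edge, so it never is
    one. *)
Lemma blocks_pre d1 s d2 : ~~ (d1 && ~~ d2) ->
  blocks (tele_edge e (S := S)) W d1 (pre s) d2 = false.
Proof. by case: d1 d2 => [] [] //= _; apply: pre_cond. Qed.

(** Only this direction holds in general: a descendant T_s can open a collider that is closed in the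
    original graph. *)
Lemma blocks_orig d1 x d2 : blocks (tele_edge e (S := S)) W d1 (orig S x) d2 ->
  blocks e V3 d1 x d2.
Proof.
case: d1 d2 => [] [] /=; rewrite ?orig_cond //.
move/forall_inP=> noW; apply/forall_inP=> w w3; apply/negP=> xw.
by have [t /noW /negP] := tele_descendant xw w3.
Qed.

(** The step into [x] is kept in front for the induction, since blocking at [x] depends on the
    directions on both sides. *)
Lemma blocked_lift d x p :
  blocked (tele_edge e (S := S)) W
    ((d, port x (~~ d)) :: lift_path x (~~ d) p) -> blocked e V3 ((d, x) :: p).
Proof.
elim: p d x => [|[d2 y] p IHp] d x.
  rewrite [lift_path _ _ _]/= /switch_ports /port; case: d => //.
  by case: insubP => // s _ _; rewrite !blocked_cons2 blocks_post blocks_pre.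
rewrite blocked_cons2 [lift_path _ _ _]/= => bl.
(* If the lift passes through [orig S x], it does so with the same directions [d] and [d2]; the
   copies [pre s] and [post s] that it meets do not block. *)
suff: blocks (tele_edge e (S := S)) W d (orig S x) d2
      || blocked (tele_edge e (S := S)) W
           ((d2, port y (~~ d2)) :: lift_path y (~~ d2) p).
  by case/orP=> [/blocks_orig->|/IHp->] //; rewrite orbT.
move: bl; rewrite /switch_ports /port.
by case: insubP => [s _ _|_]; case: d d2 => [] [];
  rewrite [_ ++ _]/= !blocked_cons2 ?blocks_post ?blocks_pre ?orFb // => ->;
  rewrite orbT.
Qed.

(** The start has no entering step. Only a detour leaving a split start along an outgoing edge adds
    inner vertices, T_x and R_x, and neither blocks. *)
Lemma blocked_lift_start x p :
  blocked (tele_edge e (S := S)) W (lift_path x false p) -> blocked e V3 p.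
Proof.
case: p => [|[d y] p] //; rewrite [lift_path _ _ _]/= => bl.
apply: blocked_lift; move: bl; rewrite /switch_ports /port; case: d => //.
case: insubP => // s _ _; rewrite [_ ++ _]/=.
by rewrite !blocked_cons2 blocks_post blocks_pre.
Qed.

Lemma d_separated_tele (V1 V2 : {set V}) :
  d_separated (tele_edge e (S := S)) [set orig S v | v in V1]
    [set orig S v | v in V2] W ->
  d_separated e V1 V2 V3.
Proof.
move=> sep x p x1 /andP[px Up] p2; apply/blocked_lift_start/(sep (orig S x)).
- exact: imset_f.
- by apply/andP; split; [apply: (traverses_lift false px)
                        | apply: (uniq_lift false Up)].
- by have /= -> := path_end_lift x false p; apply: imset_f.
Qed.

End Lift.

(** * The teleportation graph without split vertices *)

Section NoSplit.
Variables (V : finType) (e : rel V).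
Let S : {set V} := set0.

Lemma tele_unsplit (u : tele_vertex S) : u = orig S (tele_proj u).
Proof. by case: u => [//|[] [v vS]]; exfalso; rewrite inE in vS. Qed.

Lemma tele_edge_unsplit u v :
  tele_edge e (S := S) u v = e (tele_proj u) (tele_proj v).
Proof. by rewrite (tele_unsplit u) (tele_unsplit v) /= /cut_out /= inE. Qed.

Lemma acyclic_unsplit : acyclic e -> acyclic (cut_out e S).
Proof.
move=> ac c; rewrite (@eq_cycle _ _ e) => [/ac//|v w].
by rewrite /cut_out /= inE.
Qed.

Lemma connect_unsplit u v : connect (tele_edge e (S := S)) u v ->
  connect e (tele_proj u) (tele_proj v).
Proof.
case/connectP=> p up ->; apply/connectP; exists (map (@tele_proj _ _) p).
  by rewrite path_map; apply: sub_path up => a b; rewrite tele_edge_unsplit.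
by rewrite last_map.
Qed.

Definition proj_path (p : seq (bool * tele_vertex S)) : seq (bool * V) :=
  [seq (s.1, tele_proj s.2) | s <- p].

Lemma map_snd_proj_path p :
  map snd (proj_path p) = map (@tele_proj _ _) (map snd p).
Proof. by rewrite /proj_path -!map_comp; apply: eq_map. Qed.

Lemma is_path_unsplit x p :
  is_path (tele_edge e (S := S)) x p -> is_path e (tele_proj x) (proj_path p).
Proof.
case/andP=> px Up; apply/andP; split.
  elim: p x px {Up} => //= -[d y] p IHp x /= /andP[xy /IHp->].
  by rewrite -!tele_edge_unsplit xy.
(* Distinctness survives because the projection is injective when every vertex is original. *)
rewrite map_snd_proj_path -map_cons map_inj_uniq // => u v uv.
by rewrite (tele_unsplit u) uv -tele_unsplit.
Qed.

Lemma blocked_unsplit (V3 : {set V}) p : blocked e V3 (proj_path p) ->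
  blocked (tele_edge e (S := S)) ([set orig S v | v in V3] :|: post_set S) p.
Proof.
have bl d1 m d2 : blocks e V3 d1 (tele_proj m) d2 ->
    blocks (tele_edge e (S := S)) ([set orig S v | v in V3] :|: post_set S)
      d1 m d2.
  rewrite (tele_unsplit m); case: d1 d2 => [] [] /=; rewrite ?orig_cond //.
  (* A conditioned vertex [t] is original here, so it comes from [V3], and a directed path to it
     projects to one in the original graph. *)
  move/forall_inP=> no3; apply/forall_inP=> t.
  rewrite (tele_unsplit t) orig_cond => /no3.
  by apply: contra => /connect_unsplit.
elim: p => // -[d m] [|[d2 y] p] IHp //; rewrite blocked_cons2.
rewrite [proj_path _]/= blocked_cons2.
by case/orP=> [/bl->|/IHp->] //; rewrite orbT.
Qed.

End NoSplit.

Theorem mainTheorem2 (V : finType) (e : rel V) (V1 V2 V3 : {set V}) :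
  acyclic e ->
  [disjoint V1 & V2] -> [disjoint V1 & V3] -> [disjoint V2 & V3] ->
  V1 != set0 -> V2 != set0 ->
  p_separated e V1 V2 V3 <-> d_separated e V1 V2 V3.
Proof.
move=> ac _ _ _ _ _; split=> [[S _]|sep]; first exact: d_separated_tele.
exists set0; first exact: acyclic_unsplit.
move=> _ p /imsetP[x x1 ->] px /imsetP[y y2 py]; apply: blocked_unsplit.
apply: (sep x) => //; first exact: (is_path_unsplit px).
rewrite /path_end map_snd_proj_path.
by rewrite -[x]/(tele_proj (orig set0 x)) last_map -/(path_end _ _) py.
Qed.
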